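(* Let $\Psi=\{\psi_1,\dots,\psi_N\}$ be an iterated function system on $\mathbb{R}^d$ consisting of $N$ similitudes, each with the same scaling constant $c\in(0,1)$, and let $A$ be its invariant set. Let $S_0=E_A$ be the set of extreme points of the convex hull of $A$, let $S_{n+1}=\Psi(S_n)=\bigcup_{i=1}^N\psi_i(S_n)$ for $n\ge 0$, and let $\mathbf{f}_n\in L^\infty(\mathbb{N}\times\mathbb{R})$ be the persistence landscape of the degree-$0$ persistence module $H_0$ of the Čech filtration of $S_n$. Suppose that $\Psi$ has well-separated images and that for all $j,k\in\{1,\dots,N\}$ and all $n\in\mathbb{N}$, $$d(\psi_j(S_{n+1}),\psi_k(S_{n+1}))=d(\psi_j(S_n),\psi_k(S_n)).$$ Let $\delta_1=\operatorname{diam}(A)$ and, for $k\in\{2,\dots,N\}$, $\delta_k=\inf\{\varepsilon>0 : C(A,\varepsilon)\le k-1\}$, and define $\mathcal{L}:L^\infty(\mathbb{N}\times\mathbb{R})\to L^\infty(\mathbb{N}\times\mathbb{R})$ by $\mathcal{L}\mathbf{g}=\mathbf{h}$, where $$h^{(j)}=\tau_{(0,\delta_j)}\quad (1\le j\le N),\qquad h^{(kN+l)}(x)=c\,g^{(k+1)}(c^{-1}x)\quad (k\in\mathbb{N},\ 1\le l\le N).$$ Then $\mathcal{L}\mathbf{f}_n=\mathbf{f}_{n+1}$ for all $n\in\mathbb{N}$.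
   Context: $\mathbb{N}=\{1,2,\dots\}$. A similitude of $\mathbb{R}^d$ with scaling constant $c$ is a map $\psi$ with $|\psi(x)-\psi(y)|=c|x-y|$ for all $x,y$. The invariant set of $\Psi$ is the unique nonempty compact $A\subset\mathbb{R}^d$ with $A=\bigcup_{i=1}^N\psi_i(A)$. For sets, $d(Y,Z)=\inf\{|y-z|:y\in Y,z\in Z\}$. $\Psi$ has well-separated images if $\min_{1\le j\neq k\le N} d(\psi_j(A),\psi_k(A))\ge \max_{1\le j\le N}\operatorname{diam}\psi_j(A)$. $\varepsilon$-components: a set $X\subset\mathbb{R}^d$ is $\varepsilon$-connected if it is not a union of two nonempty sets $Y,Z\subset X$ with $d(Y,Z)>\varepsilon$. $Y\subseteq X$ is an $\varepsilon$-component of $X$ if $Y$ is (nonempty and) $\varepsilon$-connected and $d(Y,X\setminus Y)>\varepsilon$. $C(X,\varepsilon)$ is the number of distinct $\varepsilon$-components of $X$. Čech filtration: for $X\subset\mathbb{R}^d$ and $\varepsilon\ge0$, the Čech complex at scale $\varepsilon$ is the simplicial complex of finite nonempty $\sigma\subseteq X$ with $\bigcap_{x\in\sigma}\overline{B(x,\varepsilon/2)}\ne\emptyset$ (closed balls of radius $\varepsilon/2$); it is empty for $\varepsilon<0$. Homology has $\mathbb{Z}_2$ coefficients. For $s\le t$, $M^{s,t}$ denotes the map on $H_0$ induced by the inclusion of the complex at scale $s$ into the one at scale $t$. Hat functions: $\tau_{(0,b)}(t)=\max(0,\min(t,b-t))$. Persistence landscape: the landscape of a persistence module is the sequence $\mathbf{f}=\{f^{(n)}\}_{n\in\mathbb{N}}$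 with $f^{(n)}(t)=\sup\{m\ge 0:\operatorname{rank}M^{t-m,t+m}\ge n\}$ (the supremum of the empty set being $0$). Convention for degree $0$: the class that never dies is assigned death time $D=\operatorname{diam}(A)$, the diameter of the invariant set; that is, for $0\le s\le t$ with $t\ge D$, $\operatorname{rank}M^{s,t}$ is replaced by $\operatorname{rank}M^{s,t}-1$ in this formula. $L^\infty(\mathbb{N}\times\mathbb{R})$ is the space of sequences $\mathbf{g}=\{g^{(n)}\}_{n\in\mathbb{N}}\subset L^\infty(\mathbb{R})$ with $\|\mathbf{g}\|=\sup_n\|g^{(n)}\|_{L^\infty(\mathbb{R})}<\infty$. *)

(* Defs.v *)
From HB Require Import structures.
From mathcomp Require Import all_boot all_order all_algebra finmap.
From mathcomp Require Import all_classical all_reals all_analysis.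
From mathcomp Require Import freeg.

Set Implicit Arguments.
Unset Strict Implicit.
Unset Printing Implicit Defensive.

Import Order.TTheory GRing.Theory Num.Theory.
Import numFieldNormedType.Exports.

Local Open Scope classical_set_scope.
Local Open Scope ring_scope.

Section Euclidean.
Variables (R : realType) (d : nat).
Implicit Types (x y : 'rV[R]_d) (X Y Z A : set 'rV[R]_d).

(* The library norm on ['rV_d] is the sup norm; it induces the same topology
   as the Euclidean distance, so that [compact] can be used unchanged. *)
Definition eucl x y : R := Num.sqrt (\sum_(i < d) (x ord0 i - y ord0 i) ^+ 2).

(* Extended-real valued, so that the distance to the empty set is [+oo]. *)
Definition setdist Y Z : \bar R :=
  ereal_inf [set (eucl y z)%:E | y in Y & z in Z].

Definition diam X : R := sup [set eucl x y | x in X & y in X].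

Definition cball x (r : R) : set 'rV[R]_d := [set y | eucl x y <= r].

Definition eps_connected X (e : R) : Prop :=
  ~ exists Y Z, [/\ Y !=set0, Z !=set0, X = Y `|` Z & (e%:E < setdist Y Z)%E].

Definition eps_component X (e : R) : set (set 'rV[R]_d) :=
  [set Y | [/\ Y `<=` X, Y !=set0, eps_connected Y e
             & (e%:E < setdist Y (X `\` Y))%E]].

Definition delta A (k : nat) : R :=
  if k == 1%N then diam A
  else inf [set e : R | 0 < e /\ (eps_component A e #<= `I_k.-1)%card].

Definition convex_hull A : set 'rV[R]_d :=
  smallest (@convex_set R 'rV[R]_d) A.

Definition extreme_points A : set 'rV[R]_d :=
  [set x | A x /\ forall y z (t : R), A y -> A z -> 0 < t < 1 ->
                    x = t *: y + (1 - t) *: z -> y = x /\ z = x].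

End Euclidean.

Section IFS.
Variables (R : realType) (d N : nat) (psi : 'I_N -> 'rV[R]_d -> 'rV[R]_d).
Implicit Types A X : set 'rV[R]_d.

Definition similitude (c : R) (f : 'rV[R]_d -> 'rV[R]_d) : Prop :=
  forall x y, eucl (f x) (f y) = c * eucl x y.

Definition hutchinson X : set 'rV[R]_d := \bigcup_(i in [set: 'I_N]) (psi i @` X).

Definition invariant_set A : Prop :=
  [/\ A !=set0, compact A & A = hutchinson A].

Definition well_separated A : Prop :=
  forall i j k : 'I_N, j != k ->
    ((diam (psi i @` A))%:E <= setdist (psi j @` A) (psi k @` A))%E.

Definition approx_set A (n : nat) : set 'rV[R]_d :=
  iter n hutchinson (extreme_points (convex_hull A)).

End IFS.

Section Homology.
Local Open Scope fset_scope.
Variables (R : realType) (T : choiceType).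
Implicit Types (K L : set {fset T}) (k : nat).

(* Finitely supported 'F_2-combinations of finite sets; over 'F_2 no
   orientation of the simplices is needed. *)
Definition chain : Type := {freeg {fset T} / 'F_2}.

(* Unreduced: the boundary of a vertex is 0. *)
Definition simplex_boundary (s : {fset T}) : chain :=
  \sum_(v <- s | (1 < #|` s|)%N) << s `\ v >>.

Definition chain_boundary (z : chain) : chain := fglift simplex_boundary z.

Definition chains K k : set chain :=
  [set z | forall s, s \in dom z -> K s /\ #|` s| = k.+1].

Definition cycles K k : set chain :=
  [set z | chains K k z /\ chain_boundary z = 0].

Definition boundaries K k : set chain := chain_boundary @` chains K k.+1.

(* Rank of the map [H_k(K) -> H_k(L)] induced by an inclusion of complexes
   [K `<=` L], i.e. the dimension of its image: the largest number ([+oo] if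
   there is none) of cycles of [K] whose classes in [H_k(L)], the quotient of
   [cycles L k] by [boundaries L k], are linearly independent. *)
Definition homology_rank K L k : \bar R :=
  ereal_sup [set (n%:R : R)%:E | n in
    [set n : nat | exists z : 'I_n -> chain,
      (forall i, cycles K k (z i)) /\
      (forall a : 'I_n -> 'F_2,
        boundaries L k (\sum_(i < n) a i *: z i) -> forall i, a i = 0)]].

End Homology.

Section Landscape.
Variables (R : realType) (d : nat).
Implicit Types X A : set 'rV[R]_d.

(* For [e < 0] the closed balls are empty, hence so is the complex. *)
Definition cech X (e : R) : set {fset 'rV[R]_d} :=
  [set s | [/\ s != fset0, [set` s] `<=` X
             & \bigcap_(x in [set` s]) cball x (e / 2) !=set0]].

Definition persistence_rank X (s t : R) : \bar R :=
  homology_rank R (cech X s) (cech X t) 0.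

(* The class that never dies is assigned the death time [D]. *)
Definition truncated_rank (D : R) X (s t : R) : \bar R :=
  if (0 <= s) && (D <= t) then (persistence_rank X s t - 1)%E
  else persistence_rank X s t.

(* Landscapes are indexed by [n >= 1]; the value at [n = 0] is meaningless.
   The set below is bounded by [t], and [sup set0 = 0]. *)
Definition landscape (D : R) X (n : nat) (t : R) : R :=
  sup [set m : R | 0 <= m /\
                   ((n%:R : R)%:E <= truncated_rank D X (t - m) (t + m))%E].

End Landscape.

Section LInfinity.
Variable R : realType.
Implicit Types g h : nat -> R -> R.

(* Elements of L^oo(N x R) are represented by sequences of functions, with
   index 0 ignored, and are identified when they agree almost everywhere. *)
Definition Linf : set (nat -> R -> R) :=
  [set g | (forall n, (0 < n)%N -> measurable_fun setT (g n)) /\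
           (ereal_sup [set 'N[@lebesgue_measure R]_+oo[EFin \o g n]
                         | n in [set n : nat | (0 < n)%N]] < +oo)%E].

Definition Linf_eq g h : Prop :=
  forall n, (0 < n)%N -> {ae @lebesgue_measure R, forall x, g n x = h n x}.

Definition hat (b t : R) : R := Num.max 0 (Num.min t (b - t)).

Definition landscape_op (N : nat) (c : R) (del : nat -> R) g : nat -> R -> R :=
  fun j x => if (j <= N)%N then hat (del j) x
             else c * g ((j.-1 %/ N).+1)%N (c^-1 * x).

Lemma landscape_op_hat N c del g j x : (1 <= j <= N)%N ->
  landscape_op N c del g j x = hat (del j) x.
Proof. by case/andP=> _ jN; rewrite /landscape_op jN. Qed.

Lemma landscape_op_scale N c del g k l x : (1 <= k)%N -> (1 <= l <= N)%N ->
  landscape_op N c del g (k * N + l) x = c * g k.+1 (c^-1 * x).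
Proof.
case: l => // l k1 /= lN; have N0 : (0 < N)%N by exact: leq_ltn_trans lN.
rewrite /landscape_op ifF; last first.
  apply/negbTE; rewrite -ltnNge addnS ltnS.
  by apply: leq_trans (leq_addr _ _); rewrite leq_pmull.
by rewrite addnS /= divnMDl// divn_small// addn0.
Qed.

End LInfinity.

(* Main.v *)
(** Since balls of radius [t / 2] around [x] and [y] meet iff [|x - y| <= t], for
    [0 <= s <= t] the rank of [H_0] from scale [s] to scale [t] is the number
    [beta (X, t)] of connected components of the graph on [X] joining points at
    distance at most [t]; hence the [n]-th landscape function of [S_n] is the
    hat function whose end point is the supremum of the scales [u < D] with
    [beta (S_n, u) >= n]. Below scale [c D] the pieces [psi_i (S_n)] are not
    linked, so [beta (S_(n+1), u) = N beta (S_n, u / c)]; from scale [c D] on each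
    piece is connected and [beta <= N]. This gives the rescaled part of the
    operator. For the first [N] functions, [S_n] is [c^n D]-dense in [A], so the
    hypothesis on distances forces [d (psi_j S_n, psi_k S_n)] to be
    [d (psi_j A, psi_k A)], and at scales [>= c D] the components of [S_(n+1)] and
    of [A] are those of the same graph on the indices. Finally, the maximal
    partition of [A] into parts at mutual distance [> e] is finite, and its
    parts are exactly the [e]-components of [A]. *)

From HB Require Import structures.
Require Import Defs.
From mathcomp Require Import all_boot all_order all_algebra finmap.
From mathcomp Require Import all_classical all_reals all_analysis.
From mathcomp Require Import ess_sup_inf measurable_realfun freeg ring lra.
Local Open Scope classical_set_scope.
Local Open Scope ring_scope.

Set Implicit Arguments.
Unset Strict Implicit.
Unset Printing Implicit Defensive.

Import Order.TTheory GRing.Theory Num.Theory.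
Import numFieldNormedType.Exports.

(** * Suprema of sets of nonnegative reals *)

Section Suprema.
Variable R : realType.
Implicit Types (M V : set R) (b v : R).

Lemma sup_nonneg V : (forall v, V v -> 0 <= v) -> 0 <= sup V.
Proof.
move=> V0; have [[[w Vw] Vub]|/sup_out->//] := pselect (has_sup V).
apply: le_trans (V0 w Vw) _.
by apply: sup_upper_bound => //; split=> //; exists w.
Qed.

(** If [M] is empty, the last hypothesis forces [b = 0], which agrees with [sup set0 = 0]; so
    nonemptiness need not be checked. *)
Lemma sup_nonneg_eq M b : 0 <= b -> (forall m, M m -> 0 <= m <= b) ->
  (forall v, 0 <= v -> v < b -> exists2 m, M m & v < m) -> sup M = b.
Proof.
move=> b0 Mb bM; have [M_0|/set0P M0] := eqVneq M set0.
  rewrite M_0 sup0; apply/eqP; rewrite eq_le b0 leNgt; apply/negP => b_gt0.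
  by have [m] := bM 0 (lexx 0) b_gt0; rewrite M_0.
have hM : has_sup M by split=> //; exists b => m /Mb/andP[].
have sM m : M m -> m <= sup M by exact: sup_upper_bound.
apply/eqP; rewrite eq_le; apply/andP; split.
  by apply: sup_le_ub => // m /Mb/andP[].
rewrite leNgt; apply/negP => sb; have [m0 Mm0] := M0.
have /andP[m00 _] := Mb _ Mm0.
have [m Mm] := bM _ (le_trans m00 (sM _ Mm0)) sb.
by rewrite ltNge sM.
Qed.

Lemma sup_gt_nonneg V v : 0 <= v -> v < sup V ->
  exists2 w, V w & v < w.
Proof.
move=> v0 vV; have [V0|/set0P V0] := eqVneq V set0; last exact: sup_gt.
by move: vV; rewrite V0 sup0 ltNge v0.
Qed.

End Suprema.

(** * Euclidean distance and extreme points *)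

Section EuclideanDistance.
Variables (R : realType) (d : nat).
Implicit Types (x y z : 'rV[R]_d) (A X Y : set 'rV[R]_d).

Lemma eucl_ge0 x y : 0 <= eucl x y.
Proof. exact: sqrtr_ge0. Qed.

Lemma eucl_refl x : eucl x x = 0.
Proof. by rewrite /eucl big1 ?sqrtr0// => i _; rewrite subrr expr0n. Qed.

Lemma eucl_sym x y : eucl x y = eucl y x.
Proof. by congr Num.sqrt; apply: eq_bigr => i _; rewrite -opprB sqrrN. Qed.

Lemma eucl_eq0 x y : eucl x y = 0 -> x = y.
Proof.
move=> /eqP; rewrite sqrtr_eq0 => xy; apply/rowP => i; apply/eqP.
have S0 : \sum_(i < d) (x ord0 i - y ord0 i) ^+ 2 = 0.
  by apply/eqP; rewrite eq_le xy sumr_ge0// => j _; rewrite sqr_ge0.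
have /(_ i isT)/eqP := psumr_eq0P (fun j _ => sqr_ge0 (x ord0 j - y ord0 j)) S0.
by rewrite sqrf_eq0 subr_eq0.
Qed.

(* Lagrange's identity: [2 (|a|^2 |b|^2 - <a, b>^2)] is the sum of the squares
   of the 2x2 minors of [a] and [b]. *)
Lemma cauchy_schwarz (a b : 'I_d -> R) :
  (\sum_i a i * b i) ^+ 2 <= (\sum_i a i ^+ 2) * (\sum_i b i ^+ 2).
Proof.
rewrite -subr_ge0 -(pmulr_rge0 _ (ltr0n R 2)).
have -> : 2%:R *
    ((\sum_i a i ^+ 2) * (\sum_i b i ^+ 2) - (\sum_i a i * b i) ^+ 2) =
    \sum_i \sum_j (a i * b j - a j * b i) ^+ 2.
  have E (u v : 'I_d -> R) :
      (\sum_i u i) * (\sum_j v j) = \sum_i \sum_j u i * v j.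
    by rewrite big_distrl; apply: eq_bigr => i _; rewrite big_distrr.
  rewrite expr2 mulr_natl mulr2n -{2}[(\sum_i a i ^+ 2) * _]mulrC !E.
  rewrite -!sumrB -big_split/=; apply: eq_bigr => i _.
  rewrite -!sumrB -big_split/=; apply: eq_bigr => j _.
  by ring.
by apply: sumr_ge0 => i _; apply: sumr_ge0 => j _; rewrite sqr_ge0.
Qed.

Lemma eucl_triangle y x z : eucl x z <= eucl x y + eucl y z.
Proof.
rewrite -[leRHS]ger0_norm ?addr_ge0 ?eucl_ge0// -sqrtr_sqr ler_wsqrtr//.
pose a i := x ord0 i - y ord0 i; pose b i := y ord0 i - z ord0 i.
have a0 : 0 <= \sum_i a i ^+ 2 by apply: sumr_ge0 => i _; rewrite sqr_ge0.
have b0 : 0 <= \sum_i b i ^+ 2 by apply: sumr_ge0 => i _; rewrite sqr_ge0.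
rewrite sqrrD !sqr_sqrtr// -/a -/b.
have -> : \sum_i (x ord0 i - z ord0 i) ^+ 2 =
    \sum_i a i ^+ 2 + (\sum_i a i * b i) *+ 2 + \sum_i b i ^+ 2.
  rewrite -sumrMnl -!big_split/=; apply: eq_bigr => i _.
  by rewrite /a /b; ring.
rewrite lerD2r lerD2l lerMn2r/= -sqrtrM//.
apply: le_trans (ler_norm _) _; rewrite -sqrtr_sqr ler_wsqrtr//.
exact: cauchy_schwarz.
Qed.

Lemma eucl_midpoint x y :
  eucl x (2^-1 *: (x + y)) = eucl x y / 2 /\
  eucl y (2^-1 *: (x + y)) = eucl x y / 2.
Proof.
have half (u v : 'rV[R]_d) : (forall i, (u ord0 i - v ord0 i) ^+ 2 =
    (x ord0 i - y ord0 i) ^+ 2 * 2^-1 ^+ 2) -> eucl u v = eucl x y / 2.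
  move=> h; have -> : (2^-1 : R) = Num.sqrt (2^-1 ^+ 2).
    by rewrite sqrtr_sqr ger0_norm.
  rewrite /eucl -sqrtrM; last by apply: sumr_ge0 => i _; rewrite sqr_ge0.
  by congr Num.sqrt; rewrite big_distrl; apply: eq_bigr.
by split; apply: half => i; rewrite !mxE; field.
Qed.

Lemma setdist_le Y Z y z : Y y -> Z z -> (setdist Y Z <= (eucl y z)%:E)%E.
Proof. by move=> Yy Zz; apply: ereal_inf_lbound; exists y => //; exists z. Qed.

Lemma le_setdist Y Z (e : R) :
  (forall y z, Y y -> Z z -> e <= eucl y z) -> (e%:E <= setdist Y Z)%E.
Proof.
by move=> h; apply: le_ereal_inf_tmp => _ [y Yy [z Zz <-]]; rewrite lee_fin h.
Qed.

Lemma setdist_lt Y Z (e : R) : (setdist Y Z < e%:E)%E ->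
  exists y z, [/\ Y y, Z z & eucl y z < e].
Proof.
move=> /ereal_inf_lt[_ [y Yy [z Zz <-]]]; rewrite lte_fin => yz.
by exists y, z.
Qed.

(** Removing an extreme point from the hull leaves a convex set; were the point outside [A], this
    would contradict the minimality of the hull. *)
Lemma extreme_points_hull_sub A : extreme_points (convex_hull A) `<=` A.
Proof.
move=> x [hx ex]; apply: contrapT => Ax.
have : convex_hull A `<=` convex_hull A `\ x.
  apply: smallest_sub; last first.
    move=> a Aa; split; first exact: sub_gen_smallest.
    by move=> /= ax; apply: Ax; rewrite -ax.
  apply/convex_setW => y z; rewrite !inE => -[hy yx] [hz zx] k k0 k1.
  rewrite inE.
  split.
    move=> C [cC AC]; have := cC y z k; rewrite !inE; apply.
      exact: hy.
    exact: hz.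
  move=> /= xE; apply: yx; apply: (ex y z k%:num hy hz _ _).1 => //.
  by rewrite k0 k1.
by move=> /(_ x hx)[_]; exact.
Qed.

Lemma continuous_sum_sqr y :
  continuous (fun x => \sum_i (x ord0 i - y ord0 i) ^+ 2).
Proof.
move=> x; apply: (@cvg_big _ _ _ _ _ _ _ (nbhs x)) => [|i _].
  exact: add_continuous.
by apply: (@cvgM _ _ (nbhs x)); apply: (@cvgB _ _ _ (nbhs x));
  by [exact: coord_continuous|exact: cvg_cst].
Qed.

(* A point of [A] at maximal Euclidean norm is extreme, because the Euclidean
   norm is strictly convex. *)
Lemma extreme_points_hull_nonempty A : compact A -> A !=set0 ->
  extreme_points (convex_hull A) !=set0.
Proof.
move=> cA A0; pose q x : R := \sum_i (x ord0 i - (0 : 'rV[R]_d) ord0 i) ^+ 2.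
have qconv x y (t : R) : q (t *: x + (1 - t) *: y) =
    t * q x + (1 - t) * q y - t * (1 - t) * \sum_i (x ord0 i - y ord0 i) ^+ 2.
  rewrite /q !big_distrr -sumrN -!big_split/=; apply: eq_bigr => i _.
  by rewrite !mxE; ring.
have cq : {within A, continuous q}.
  by apply: continuous_subspaceT; exact: continuous_sum_sqr.
have [p Ap pmax] := compact_EVT_max A0 cA cq; rewrite inE in Ap.
(* The Euclidean ball through [p] centred at the origin is convex and contains [A], hence contains
   the hull. *)
have hullq x : convex_hull A x -> q x <= q p.
  move=> /(_ [set z | q z <= q p]); apply; split; last first.
    by move=> a Aa /=; apply: pmax; rewrite inE.
  apply/convex_setW => y z; rewrite !inE => qy qz k k0 k1; rewrite inE.
  rewrite /= in qy qz *.
  rewrite -[X in q X]/(k%:num *: y + (1 - k%:num) *: z) qconv.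
  rewrite lerBlDr; apply: (@le_trans _ _ (k%:num * q p + (1 - k%:num) * q p)).
    by apply: lerD; apply: ler_wpM2l => //; rewrite subr_ge0 ltW.
  rewrite -mulrDl addrC subrK mul1r lerDl; apply: mulr_ge0.
    by apply: mulr_ge0; rewrite ?subr_ge0 ltW.
  by apply: sumr_ge0 => i _; rewrite sqr_ge0.
exists p; split; first exact: sub_gen_smallest.
move=> y z t hy hz /andP[t0 t1] pE.
suff yz : y = z by move: pE; rewrite yz -scalerDl addrC subrK scale1r => ->.
apply: eucl_eq0; rewrite /eucl; apply/eqP; rewrite sqrtr_eq0.
have tt : 0 < t * (1 - t) by rewrite mulr_gt0// subr_gt0.
rewrite -(pmulr_rle0 _ tt) -subr_ge0 sub0r.
have := qconv y z t; rewrite -pE.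
have : t * q y <= t * q p by rewrite ler_pM2l// hullq.
have : (1 - t) * q z <= (1 - t) * q p by rewrite ler_pM2l ?subr_gt0// hullq.
by lra.
Qed.

Lemma compact_eucl_bounded A : compact A ->
  exists M, forall x y, A x -> A y -> eucl x y <= M.
Proof.
move=> cA; have [A0|A0] := pselect (A !=set0); last first.
  by exists 0 => x y Ax; exfalso; apply: A0; exists x.
pose q x : R := eucl x 0.
have cq : {within A, continuous q}.
  apply: continuous_subspaceT => x.
  apply: (@continuous_comp _ _ _
    (fun z => \sum_i (z ord0 i - (0 : 'rV[R]_d) ord0 i) ^+ 2) Num.sqrt).
    exact: continuous_sum_sqr.
  exact: sqrt_continuous.
have [p _ pmax] := compact_EVT_max A0 cA cq.
exists (q p + q p) => x y Ax Ay; apply: le_trans (eucl_triangle 0 _ _) _.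
by apply: lerD; [|rewrite eucl_sym]; apply: pmax; rewrite inE.
Qed.

Lemma eucl_le_diam A x y :
  (exists M, forall x y, A x -> A y -> eucl x y <= M) ->
  A x -> A y -> eucl x y <= diam A.
Proof.
move=> [M AM] Ax Ay; apply: sup_upper_bound.
  split; first by exists (eucl x y), x => //; exists y.
  by exists M => _ [u Au [v Av <-]]; exact: AM.
by exists x => //; exists y.
Qed.

Lemma diam_le A (M : R) : 0 <= M ->
  (forall x y, A x -> A y -> eucl x y <= M) -> diam A <= M.
Proof.
move=> M0 AM; have [-> /=|A0] := pselect (A = set0).
  rewrite /diam; set S := (X in sup X).
  by rewrite (_ : S = set0) ?sup0//; apply/seteqP; split => [r [x []]|].
apply: sup_le_ub; last by move=> _ [u Au [v Av <-]]; exact: AM.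
have /set0P[x Ax] : A != set0 by exact/eqP.
by exists (eucl x x), x => //; exists x.
Qed.

Lemma diam_ge0 A : 0 <= diam A.
Proof.
by apply: sup_nonneg => _ [x _ [y _ <-]]; exact: eucl_ge0.
Qed.

End EuclideanDistance.

(** * Degree-0 homology of a graph *)

(** Supplies a maximal number of labels once some number is known to be impossible. *)
Lemma nat_jump (P : nat -> Prop) n : P 0%N -> ~ P n ->
  exists m, [/\ (m < n)%N, P m & ~ P m.+1].
Proof.
move=> P0; elim: n => // n IH nn.
have [Pn|/IH[m [mn Pm Pm1]]] := pselect (P n); first by exists n.
by exists m; split=> //; exact: leq_trans mn _.
Qed.

Section Labels.
Variables (T : Type) (X : set T) (e : T -> T -> Prop).

(* [labels k g] witnesses that the graph [e] on [X] has at least [k] connected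
   components; values of [g] other than [0], .., [k-1] are allowed. *)
Definition labels (k : nat) (g : T -> nat) : Prop :=
  (forall x y, X x -> X y -> e x y -> g x = g y) /\
  (forall i, (i < k)%N -> exists2 x, X x & g x = i).

Definition has_labels (k : nat) : Prop := exists g, labels k g.

Lemma has_labels_leq k l : (k <= l)%N -> has_labels l -> has_labels k.
Proof.
move=> kl [g [ge gs]]; exists g; split=> // i ik.
by apply: gs; exact: leq_trans kl.
Qed.

Lemma has_labels0 : has_labels 0.
Proof. by exists (fun=> 0%N). Qed.

Lemma has_labels1 : X !=set0 -> has_labels 1.
Proof. by move=> [x Xx]; exists (fun=> 0%N); split=> // -[] // _; exists x. Qed.

(** Labels are renumbered by their position in [s]; those outside [s] all become [size s], a surplus
    value that [labels] allows. *)
Lemma has_labels_seq (s : seq nat) (g : T -> nat) :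
  (forall x y, X x -> X y -> e x y -> g x = g y) -> uniq s ->
  (forall j, j \in s -> exists2 x, X x & g x = j) -> has_labels (size s).
Proof.
move=> ge us gs; exists (fun x => index (g x) s); split.
  by move=> x y Xx Xy /(ge _ _ Xx Xy) ->.
move=> i si; have [x Xx gx] := gs _ (mem_nth 0%N si).
by exists x => //; rewrite gx index_uniq.
Qed.

(* Otherwise [S] would split a label in two. *)
Lemma labels_max_closed m g (S : set T) : ~ has_labels m.+1 ->
  labels m g -> (forall x, X x -> (g x < m)%N) ->
  (forall x y, X x -> X y -> S x -> (e x y \/ e y x) -> S y) ->
  forall x y, X x -> X y -> g x = g y -> S x -> S y.
Proof.
move=> nm [ge gs] gm Scl x y Xx Xy gxy Sx; apply: contrapT => nSy; apply: nm.
(* Points of [S] with the label of [x] get the new label [m], while [y] keeps the old one. *)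
exists (fun z => if `[< S z >] && (g z == g x) then m else g z); split.
  move=> u v Xu Xv uv; rewrite (ge _ _ Xu Xv uv).
  case: asboolP => Su; case: asboolP => Sv //=; exfalso.
    by apply: Sv; apply: (Scl u); first [done|left].
  by apply: Su; apply: (Scl v); first [done|right].
move=> i; rewrite ltnS leq_eqVlt => /orP[/eqP->|im].
  by exists x => //; case: asboolP => //= _; rewrite eqxx.
have [->|ix] := eqVneq i (g x).
  by exists y => //; case: asboolP.
by have [z Xz gz] := gs _ im; exists z => //; rewrite gz (negbTE ix) andbF.
Qed.

(** Surplus values are merged into label 0. For [m = 0] there is no label to merge into, but then
    [X] is empty. *)
Lemma labels_trim m : ~ has_labels m.+1 -> has_labels m ->
  exists2 g, labels m g & forall x, X x -> (g x < m)%N.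
Proof.
move=> nm [g [ge gs]]; case: m => [|m] in nm gs *.
  by exists g => // x Xx; case: nm; apply: has_labels1; exists x.
exists (fun x => if (g x < m.+1)%N then g x else 0%N); last first.
  by move=> x Xx; case: ifP.
split=> [x y Xx Xy xy|i im]; first by rewrite (ge _ _ Xx Xy xy).
by have [x Xx gx] := gs i im; exists x => //; rewrite gx im.
Qed.

End Labels.

(** * Linear extension of maps to chains, and scalars in the field with two elements *)

Section FreeModule.
Variables (K : choiceType) (F : comNzRingType) (M : lmodType F).
Implicit Types (f : K -> M) (D : {freeg K / F}).

HB.instance Definition _ f :=
  GRing.isZmodMorphism.Build {freeg K / F} M (fglift f) (lift_is_additive f).

Lemma fglift_sum f D : fglift f D = \sum_(x <- dom D) coeff x D *: f x.
Proof.
rewrite -{1}(freeg_sumE D) raddf_sum; apply: eq_bigr => x _.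
exact: liftU.
Qed.

End FreeModule.

Lemma F2_cases (a : 'F_2) : a = 0 \/ a = 1.
Proof. by case: a => -[|[|]]// i; [left|right]; apply/val_inj. Qed.

Lemma F2_addvv (V : lmodType 'F_2) (v : V) : v + v = 0.
Proof.
by rewrite -mulr2n -scaler_nat (_ : 2%:R = 0) ?scale0r//; apply/val_inj.
Qed.

Lemma F2_raddfZ (V W : lmodType 'F_2) (f : {additive V -> W}) a v :
  f (a *: v) = a *: f v.
Proof. by have [->|->] := F2_cases a; rewrite ?scale0r ?raddf0 ?scale1r. Qed.

Section GraphHomology.
Local Open Scope fset_scope.
Local Open Scope ring_scope.
Variables (T : choiceType) (X : set T) (e : T -> T -> Prop).
Variables (K L : set {fset T}).
Hypothesis Kvertex : forall x, K [fset x] <-> X x.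
Hypothesis Ledge : forall x y, x != y ->
  L [fset x; y] <-> [/\ X x, X y & e x y].
Hypothesis e_sym : forall x y, e x y -> e y x.

(** On vertices, the indicator cochain of a label class. For a labelling constant along edges it is
    a cocycle, so its lift is a functional on [H_0]. *)
Definition label_chain (g : T -> nat) (i : nat) (s : {fset T}) : ('F_2)^o :=
  \sum_(v <- s) (g v == i)%:R.

Lemma simplex_boundary_vertex x : @simplex_boundary T [fset x] = 0.
Proof. by rewrite /simplex_boundary big_pred0// => v; rewrite cardfs1. Qed.

Lemma simplex_boundary_edge x y : x != y ->
  @simplex_boundary T [fset x; y] = << [fset y] >> + << [fset x] >>.
Proof.
move=> xy; rewrite /simplex_boundary (eq_bigl xpredT); last first.
  by move=> v; rewrite cardfs2 xy.
have yx : y \notin [fset x] by rewrite inE eq_sym.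
rewrite big_fsetU1 ?inE//= big_seq_fset1; congr (_ + _).
  by rewrite fsetU1K// inE.
by rewrite fsetUC fsetU1K.
Qed.

Lemma fset_edge (s : {fset T}) : #|` s| = 2%N ->
  exists x y, x != y /\ s = [fset x; y].
Proof.
move=> s2; have [x xs] : exists x, x \in s.
  by apply/fset0Pn; rewrite -cardfs_gt0 s2.
have : #|` s `\ x| = 1%N.
  by apply/eqP; move: s2; rewrite (cardfsD1 x) xs add1n => -[->].
move=> /eqP/cardfs1P[y sy]; exists x, y.
have : y \in s `\ x by rewrite sy inE.
rewrite !inE eq_sym => /andP[xy _]; split=> //.
by rewrite -sy fsetD1K.
Qed.

(** The two end points of an edge carry the same label, so their contributions cancel modulo 2. *)
Lemma label_chain_boundary g i (w : chain T) :
  (forall x y, X x -> X y -> e x y -> g x = g y) -> chains L 1 w ->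
  fglift (label_chain g i) (chain_boundary w) = 0.
Proof.
move=> ge Lw; rewrite /chain_boundary (fglift_sum (@simplex_boundary T)).
rewrite raddf_sum big_seq.
apply: big1 => s /Lw[Ls /fset_edge[x [y [xy sE]]]].
rewrite F2_raddfZ sE simplex_boundary_edge// raddfD/= !liftU !scale1r.
rewrite /label_chain !big_seq_fset1.
move: Ls; rewrite sE => /(Ledge xy)[Xx Xy exy].
by rewrite (ge _ _ Xx Xy exy) F2_addvv scaler0.
Qed.

Lemma boundariesD k (w w' : chain T) : boundaries L k w -> boundaries L k w' ->
  boundaries L k (w + w').
Proof.
move=> [u Lu <-] [v Lv <-]; exists (u + v); last first.
  by rewrite /chain_boundary raddfD.
by move=> s /domD_subset; rewrite mem_cat => /orP[/Lu|/Lv].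
Qed.

Lemma boundaries0 k : boundaries L k (0 : chain T).
Proof.
by exists 0; [move=> s; rewrite dom0|rewrite /chain_boundary raddf0].
Qed.

(** The vertices homologous to [x] form a set closed under edges; by maximality of [m] such a set
    contains the whole label class of [x]. No paths are needed. *)
Lemma boundaries_vertices m g x y : ~ has_labels X e m.+1 -> labels X e m g ->
  (forall z, X z -> (g z < m)%N) -> X x -> X y -> g x = g y ->
  boundaries L 0 (<< [fset x] >> + << [fset y] >> : chain T).
Proof.
move=> nm gl gm Xx Xy gxy.
apply: (labels_max_closed (S := fun z => boundaries L 0
  (<< [fset x] >> + << [fset z] >> : chain T)) nm gl gm _ Xx Xy gxy); last first.
  by rewrite F2_addvv; exact: boundaries0.
move=> u v Xu Xv bu uv; have [->//|vu] := eqVneq v u.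
suff : boundaries L 0 (<< [fset u] >> + << [fset v] >> : chain T).
  move=> /(boundariesD bu); congr boundaries.
  by rewrite -addrA [X in _ + X]addrA F2_addvv add0r.
exists << [fset v; u] >>; last first.
  by rewrite /chain_boundary liftU scale1r simplex_boundary_edge.
move=> s; rewrite domU1 inE => /eqP->; rewrite cardfs2 vu; split=> //.
by apply/Ledge => //; split=> //; case: uv => // /e_sym.
Qed.

(* Modulo boundaries a vertex may be replaced by a representative of its label. *)
Lemma boundaries_label_chain0 m g (w : chain T) : ~ has_labels X e m.+1 ->
  labels X e m g -> (forall z, X z -> (g z < m)%N) -> chains K 0 w ->
  (forall j : 'I_m, fglift (label_chain g j) w = 0) -> boundaries L 0 w.
Proof.
move=> nm gl gm Kw w0.
have /choice[r rP] : forall i : 'I_m, exists x, X x /\ g x = i.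
  by move=> i; have [x] := gl.2 i (ltn_ord i); exists x.
(* The added representatives sum to zero, because every label functional vanishes on [w]. *)
have wE : w = \sum_(s <- dom w) coeff s w *:
    (<< s >> + \sum_(j < m) label_chain g j s *: << [fset r j] >>).
  under eq_bigr do rewrite scalerDr; rewrite big_split/=.
  have -> : \sum_(s <- dom w) coeff s w *:
      \sum_(j < m) label_chain g j s *: << [fset r j] >> = 0 :> chain T.
    under eq_bigr do rewrite scaler_sumr; rewrite exchange_big/= big1// => j _.
    under eq_bigr do rewrite scalerA; rewrite -scaler_suml.
    by have := w0 j; rewrite fglift_sum => ->; rewrite scale0r.
  rewrite addr0 -[LHS]freeg_sumE; apply: eq_bigr => s _.
  by apply/eqP/freeg_eqP => x; rewrite coeffZ !coeffU mul1r.
rewrite wE big_seq; apply: big_ind; [exact: boundaries0|exact: boundariesD|].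
move=> s /Kw[Ks /eqP/cardfs1P[x sE]].
have Xx : X x by apply/Kvertex; rewrite -sE.
have [->|->] := F2_cases (coeff s w).
  by rewrite scale0r; exact: boundaries0.
rewrite scale1r sE (bigD1 (Ordinal (gm _ Xx)))//= big1; last first.
  move=> j; rewrite -val_eqE/= => jx.
  by rewrite /label_chain big_seq_fset1 eq_sym (negbTE jx) scale0r.
rewrite addr0 /label_chain big_seq_fset1 eqxx scale1r.
have [Xr gr] := rP (Ordinal (gm _ Xx)).
exact: (boundaries_vertices nm gl gm).
Qed.

(** If at most [m < n] labels exist, the [n] by [m] matrix of label functionals on the cycles has a
    nonzero left kernel vector, and the corresponding combination is a boundary. Conversely,
    vertices representing [n] labels are independent, since the functional of label [j] reads off
    the [j]-th coefficient. *)
Lemma independent_cycles_labels n :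
  (exists z : 'I_n -> chain T, (forall i, cycles K 0 (z i)) /\
    forall a : 'I_n -> 'F_2, boundaries L 0 (\sum_(i < n) a i *: z i) ->
      forall i, a i = 0) <-> has_labels X e n.
Proof.
split=> [[z [cz zind]]|[g [ge gs]]].
  apply: contrapT => /(nat_jump (has_labels0 X e))[m [mn hm nm]].
  have [g gl gm] := labels_trim nm hm.
  pose M : 'M['F_2]_(n, m) := \matrix_(i, j) fglift (label_chain g j) (z i).
  have : kermx M != 0.
    by rewrite kermx_eq0 /row_free neq_ltn (leq_ltn_trans (rank_leq_col M) mn).
  move=> /rowV0Pn[a /sub_kermxP aM] a0.
  case/negP: a0; apply/eqP/rowP => i; rewrite mxE.
  apply: (zind (a ord0)) i.
  apply: (boundaries_label_chain0 nm gl gm).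
    move=> s /dom_sum_subset/flattenP[_ /mapP[i _ ->]] /domZ_subset.
    exact: (cz i).1.
  move=> j; rewrite raddf_sum; move/rowP: aM => /(_ j); rewrite !mxE => aMj.
  by rewrite -[RHS]aMj; apply: eq_bigr => i _; rewrite mxE F2_raddfZ.
have /choice[r rP] : forall i : 'I_n, exists x, X x /\ g x = i.
  by move=> i; have [x] := gs i (ltn_ord i); exists x.
exists (fun i => << [fset r i] >>); split=> [i|a [w Lw wE] j].
  split; last by rewrite /chain_boundary liftU simplex_boundary_vertex scaler0.
  move=> s; rewrite domU1 inE => /eqP ->; rewrite cardfs1; split=> //.
  by apply/Kvertex; exact: (rP i).1.
have := label_chain_boundary j ge Lw.
rewrite wE raddf_sum (bigD1 j)//= big1 => [|i ij]; rewrite F2_raddfZ/=.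
  rewrite liftU scale1r /label_chain big_seq_fset1 (rP j).2 eqxx addr0 => <-.
  by rewrite /GRing.scale/= mulr1.
rewrite liftU scale1r /label_chain big_seq_fset1 (rP i).2 val_eqE.
by rewrite (negbTE ij) scaler0.
Qed.

Lemma homology_rank0_ge (R : realType) n : (0 < n)%N ->
  ((n%:R : R)%:E <= homology_rank R K L 0)%E <-> has_labels X e n.
Proof.
move=> n0; split=> [|hn]; last first.
  by apply: ereal_sup_ubound; exists n => //; exact/independent_cycles_labels.
apply: contraPP => hn; apply/negP; rewrite -ltNge.
apply: (@le_lt_trans _ _ (n.-1%:R : R)%:E); last first.
  by rewrite lte_fin ltr_nat prednK.
apply: ge_ereal_sup => _ [k /independent_cycles_labels hk <-].
rewrite lee_fin ler_nat -ltnS prednK// ltnNge; apply/negP => nk.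
exact/hn/(has_labels_leq nk).
Qed.

End GraphHomology.

(** * Landscapes *)

Section Landscapes.
Local Open Scope fset_scope.
Local Open Scope ring_scope.
Variables (R : realType) (d : nat).
Implicit Types (X : set 'rV[R]_d) (x y : 'rV[R]_d) (D s t u : R).

(** Encodes [beta (X, u) >= k] through a labelling, so that infinitely many components need no
    separate treatment. *)
Definition splits X u k : Prop := has_labels X (fun x y => eucl x y <= u) k.

Lemma splits_le X u v k : u <= v -> splits X v k -> splits X u k.
Proof.
move=> uv [g [ge gs]]; exists g; split=> // x y Xx Xy xy.
by apply: ge => //; exact: le_trans uv.
Qed.

Lemma splits_diam X u k : (forall x y, X x -> X y -> eucl x y <= u) ->
  (1 < k)%N -> ~ splits X u k.
Proof.
move=> Xu k1 [g [ge gs]]; have [x Xx gx] := gs 0%N (ltnW k1).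
have [y Xy gy] := gs 1%N k1.
by have := ge _ _ Xx Xy (Xu _ _ Xx Xy); rewrite gx gy.
Qed.

Lemma cech_vertex X s x : 0 <= s -> cech X s [fset x] <-> X x.
Proof.
move=> s0; split=> [[_ Xx _]|Xx].
  by apply: Xx; rewrite /= inE.
split; first by apply/fset0Pn; exists x; rewrite inE.
  by move=> y /=; rewrite inE => /eqP->.
exists x => y /=; rewrite inE => /eqP->.
by rewrite /cball/= eucl_refl divr_ge0.
Qed.

Lemma cech_edge X t x y : x != y ->
  cech X t [fset x; y] <-> [/\ X x, X y & eucl x y <= t].
Proof.
move=> xy; split=> [[_ Xxy [z zb]]|[Xx Xy xyt]].
  split; [by apply: Xxy; rewrite /= !inE eqxx|
    by apply: Xxy; rewrite /= !inE eqxx orbT|].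
  have xz : eucl x z <= t / 2 by apply: zb; rewrite /= !inE eqxx.
  have yz : eucl y z <= t / 2 by apply: zb; rewrite /= !inE eqxx orbT.
  rewrite (le_trans (eucl_triangle z _ _))// (eucl_sym z) [leRHS]splitr.
  exact: lerD.
split; first by apply/fset0Pn; exists x; rewrite !inE eqxx.
  by move=> z /=; rewrite !inE => /orP[] /eqP->.
have [xm ym] := eucl_midpoint x y.
exists (2^-1 *: (x + y)) => z /=; rewrite !inE /cball/= => /orP[] /eqP->.
  by rewrite xm ler_pM2r.
by rewrite ym ler_pM2r.
Qed.

Lemma persistence_rank_ge X s t n : 0 <= s -> s <= t -> (0 < n)%N ->
  ((n%:R : R)%:E <= persistence_rank X s t)%E <-> splits X t n.
Proof.
move=> s0 st n0; apply: homology_rank0_ge => //.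
- by move=> x; exact: cech_vertex.
- by move=> x y; exact: cech_edge.
- by move=> x y; rewrite eucl_sym.
Qed.

(** Balls of negative radius are empty, so the only chain is 0 and no nonempty family is
    independent. *)
Lemma persistence_rank_neg X s t : s < 0 -> (persistence_rank X s t <= 0)%E.
Proof.
move=> s0; apply: ge_ereal_sup => _ [n [z [cz zind]] <-].
case: n => [|n] in z cz zind *; first by rewrite lexx.
have z0 i : z i = 0.
  apply/eqP; rewrite -dom_eq0; case E : (dom (z i)) => [//|a l].
  have [] := (cz i).1 a; first by rewrite E inE eqxx.
  case=> /fset0Pn[x xa] _ [y /(_ x xa)]; rewrite /cball/= => xy _.
  have := le_trans (eucl_ge0 x y) xy.
  by rewrite pmulr_lge0 ?invr_gt0// leNgt s0.
have /(_ ord0)/eqP : forall i : 'I_n.+1, 1 = 0 :> 'F_2.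
  apply: (zind (fun=> 1)); under eq_bigr do rewrite z0 scaler0.
  by rewrite big1//; exact: boundaries0.
by rewrite oner_eq0.
Qed.

(** The bound [u < D] matters only for [n <= 1], where it is the death time given to the immortal
    class; for larger [n] it is automatic on sets of diameter at most [D]. *)
Definition split_times D X n : set R :=
  [set u | [/\ 0 <= u, u < D & splits X u n]].

(** From scale [D] on all points are linked, so the rank is at most 1 and the correction by 1 leaves
    nothing positive. *)
Lemma truncated_rank_ge D X s t n : (forall x y, X x -> X y -> eucl x y <= D) ->
  s <= t -> (0 < n)%N ->
  ((n%:R : R)%:E <= truncated_rank D X s t)%E <-> 0 <= s /\ split_times D X n t.
Proof.
move=> XD st n0; rewrite /truncated_rank.
have [s0|s0] := ltP s 0.
  rewrite andFb; split=> [h|[]//].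
  have := le_trans h (persistence_rank_neg X t s0).
  by rewrite lee_fin lern0 eqn0Ngt n0.
have t0 := le_trans s0 st.
rewrite andTb; have [Dt|Dt] := leP D t.
  split=> [h|[_ []]]; last by rewrite ltNge Dt.
  exfalso; apply: (@splits_diam X t n.+1) => //.
    by move=> x y Xx Xy; exact: le_trans (XD _ _ Xx Xy) Dt.
  apply/(persistence_rank_ge X s0 st) => //.
  by move: h; rewrite leeBrDr// -EFinD natr1.
split=> [/(persistence_rank_ge X s0 st n0)|[_ [_ _ h]]] //.
exact/(persistence_rank_ge X s0 st n0).
Qed.

Lemma sup_downset_hat (U : set R) t : has_ubound U ->
  (forall u v, U v -> 0 <= u -> u <= v -> U u) ->
  sup [set m | 0 <= m /\ 0 <= t - m /\ U (t + m)] = hat (sup U) t.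
Proof.
move=> Ub Ud; apply: sup_nonneg_eq; first by rewrite le_max lexx.
  move=> m [m0 [tm Um]]; rewrite m0/= le_max le_min; apply/orP; right.
  have Us : t + m <= sup U.
    by apply: sup_upper_bound => //; split=> //; exists (t + m).
  by apply/andP; split; lra.
move=> v v0; rewrite lt_max ltNge v0/= lt_min => /andP[vt vU].
have [||w Uw tvw] := @sup_gt_nonneg _ U (t + v); [lra|lra|].
exists (Num.min t (w - t)); last by rewrite lt_min vt; lra.
have tw : 0 <= Num.min t (w - t) by rewrite le_min; apply/andP; split; lra.
have mt : Num.min t (w - t) <= t by rewrite ge_min lexx.
have mw : Num.min t (w - t) <= w - t by rewrite ge_min lexx orbT.
split=> //; split; first by rewrite subr_ge0.
by apply: (Ud _ w) => //; lra.
Qed.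

Lemma landscape_hat D X n : (forall x y, X x -> X y -> eucl x y <= D) ->
  (0 < n)%N -> landscape D X n = hat (sup (split_times D X n)).
Proof.
move=> XD n0; apply/funext => t; rewrite -sup_downset_hat.
- congr sup; apply/seteqP; split=> m /=.
    move=> [m0 /(truncated_rank_ge XD) h]; split=> //; apply: h => //.
    by rewrite lerD2l; lra.
  move=> [m0 h]; split=> //; apply/(truncated_rank_ge XD) => //.
  by rewrite lerD2l; lra.
- by exists D => u [_ /ltW].
- move=> u v [v0 vD vs] u0 uv; split=> //; first exact: le_lt_trans vD.
  exact: splits_le vs.
Qed.

End Landscapes.

(** * Components at scale e *)

Section Components.
Variables (R : realType) (d : nat).
Implicit Types (A X Y Z : set 'rV[R]_d) (x y : 'rV[R]_d) (e u : R).

(** Components must be at distance strictly more than [e], so they are the classes of a labelling at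
    some scale strictly above [e]. *)
Definition splits_above X e k : Prop := exists2 u, e < u & splits X u k.

Lemma splits_above_leq X e k l : (k <= l)%N -> splits_above X e l ->
  splits_above X e k.
Proof. by move=> kl [u eu h]; exists u => //; exact: has_labels_leq h. Qed.

Lemma setdist_gt Y Z e : (e%:E < setdist Y Z)%E ->
  exists2 r, e < r & forall y z, Y y -> Z z -> r <= eucl y z.
Proof.
have YZ := @setdist_le R d Y Z; move: YZ.
case: (setdist Y Z) => [r| |//] YZ er.
  by exists r => // y z Yy Zz; rewrite -lee_fin YZ.
exists (e + 1); first by rewrite ltrDl.
by move=> y z Yy Zz; have := YZ _ _ Yy Zz.
Qed.

Section Fibres.
Variables (X : set 'rV[R]_d) (e u : R) (m : nat) (g : 'rV[R]_d -> nat).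
Hypotheses (eu : e < u) (nm : ~ splits_above X e m.+1).
Hypothesis gl : labels X (fun x y => eucl x y <= u) m g.
Hypothesis gm : forall x, X x -> (g x < m)%N.
Hypothesis e0 : 0 <= e.

Let fibre i : set 'rV[R]_d := [set x | X x /\ g x = i].

Lemma far_of_label x y : X x -> X y -> g x <> g y -> u < eucl x y.
Proof. by move=> Xx Xy gxy; rewrite ltNge; apply/negP => /(gl.1 _ _ Xx Xy). Qed.

(** A splitting of a fibre at distance [r > e] would give one more label at a scale [v] with
    [e < v <= u] and [v < r]. *)
Lemma fibre_connected i : eps_connected (fibre i) e.
Proof.
move=> [Y [Z [[y Yy] [z Zz] iYZ /setdist_gt[r er YZr]]]].
pose v := Num.min u ((e + r) / 2).
have ev : e < v by rewrite lt_min eu/=; lra.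
have vu : v <= u by rewrite ge_min lexx.
have vr : v < r by rewrite gt_min; apply/orP; right; lra.
have nv : ~ splits X v m.+1 by move=> h; apply: nm; exists v.
have gv : labels X (fun x y => eucl x y <= v) m g.
  split; last exact: gl.2.
  by move=> a b Xa Xb ab; apply: gl.1 => //; exact: le_trans vu.
have iY a : Y a -> X a /\ g a = i.
  by move=> Ya; have : (Y `|` Z) a by [left]; rewrite -iYZ.
have iZ a : Z a -> X a /\ g a = i.
  by move=> Za; have : (Y `|` Z) a by [right]; rewrite -iYZ.
have Zy : Z y.
  apply: (labels_max_closed (S := Z) nv gv gm _ (iZ z Zz).1 (iY y Yy).1) => //.
    move=> a b Xa Xb Za ab.
    have abv : eucl b a <= v by case: ab => //; rewrite eucl_sym.
    have : fibre i b by split=> //; rewrite -(iZ a Za).2; exact: gv.1.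
    rewrite iYZ => -[Yb|//]; have := YZr _ _ Yb Za.
    by rewrite leNgt (le_lt_trans abv vr).
  by rewrite (iY y Yy).2 (iZ z Zz).2.
by have := YZr _ _ Yy Zy; rewrite eucl_refl leNgt (le_lt_trans e0 er).
Qed.

Lemma fibre_component i : (i < m)%N -> eps_component X e (fibre i).
Proof.
move=> im; split; first by move=> x [].
- by have [x Xx gx] := gl.2 i im; exists x.
- exact: fibre_connected.
apply: (@lt_le_trans _ _ u%:E); first by rewrite lte_fin.
apply: le_setdist => x y [Xx gx] [Xy ny]; apply/ltW/far_of_label => //.
by rewrite gx => gy; apply: ny; split.
Qed.

(* Two overlapping e-components coincide, each being e-connected and at
   distance more than e from the rest of [X]. *)
Lemma component_overlap Y Z x : eps_component X e Y -> eps_component X e Z ->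
  Y x -> Z x -> Y `<=` Z.
Proof.
move=> [YX _ cY _] [_ _ _ dZ] Yx Zx y Yy; apply: contrapT => nZy; apply: cY.
exists (Y `&` Z), (Y `\` Z); split; [by exists x|by exists y| |].
  by rewrite setUIDK.
apply: lt_le_trans dZ _.
apply: le_ereal_inf_tmp => _ [a [Ya Za] [b [Yb nZb] <-]].
by apply: setdist_le => //; split=> //; exact: YX.
Qed.

Lemma componentsE : eps_component X e = fibre @` `I_m.
Proof.
apply/seteqP; split=> [Y cY|_ [i im <-]]; last exact: fibre_component.
have [YX [y Yy] _ _] := cY; have Xy := YX _ Yy.
exists (g y); first exact: gm.
have cF := fibre_component (gm Xy).
by apply/seteqP; split; apply: component_overlap; eauto; split.
Qed.

Lemma card_components k : (eps_component X e #<= `I_k)%card <-> (m <= k)%N.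
Proof.
have : (eps_component X e #= `I_m)%card.
  rewrite componentsE; apply: inj_card_eq => i j; rewrite !inE => im jm ij.
  have [x Xx gx] := gl.2 i im; have : fibre j x by rewrite -ij.
  by move=> [_ <-].
by move=> /card_eqPle h; rewrite -card_le_II; split; apply: card_le_trans; apply h.
Qed.

End Fibres.

(** The bound [M] yields a largest number [m] of labels at scales above [e]; the fibres of a
    labelling with [m] labels are then all the components. *)
Lemma card_eps_components X e k M : 0 <= e -> 
  (forall j, splits X e j -> (j <= M)%N) ->
  (eps_component X e #<= `I_k)%card <-> ~ splits_above X e k.+1.
Proof.
move=> e0 XM.
have : ~ splits_above X e M.+1.
  by move=> [u /ltW eu /(splits_le eu)/XM]; rewrite ltnn.
have h0 : splits_above X e 0.
  by exists (e + 1); rewrite ?ltrDl//; exact: has_labels0.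
move=> /(nat_jump h0)[m [_ [u eu hm] nm]].
have nu : ~ splits X u m.+1 by move=> h; apply: nm; exists u.
have [g gl gm] := labels_trim nu hm.
rewrite (card_components eu nm gl gm e0); split=> [mk h|nk].
  exact/nm/(splits_above_leq _ h).
rewrite leqNgt; apply/negP => km; apply: nk; exists u => //.
exact: has_labels_leq hm.
Qed.

End Components.

(** * The landscape operator on essentially bounded sequences *)

(** The pushforward of Lebesgue measure by the dilation, multiplied by [a], agrees with Lebesgue
    measure on half-open intervals; uniqueness gives the rest. *)
Lemma lebesgue_measure_dilation (R : realType) (a : R) (A : set R) :
  0 < a -> measurable A ->
  (a%:E * @lebesgue_measure R (( *%R a) @^-1` A) = lebesgue_measure A)%E.
Proof.
move=> a0 mA.
have mf : measurable_fun setT ( *%R a : measurableTypeR R -> measurableTypeR R).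
  exact: mulrl_measurable.
pose dil := measure_function_pushforward__canonical__measure_function_Measure
  (@lebesgue_measure R) mf.
apply/esym; pose k := NngNum (ltW a0).
apply: (@lebesgue_measure_unique R (mscale k dil)) => // _ [[x y]] _ <-.
rewrite /mscale /dil /pushforward/=.
transitivity
  (a%:E * (@lebesgue_measure R `](x / a)%R, (y / a)%R]%classic))%E; last first.
  congr (_ * lebesgue_measure _)%E; apply/seteqP.
  by split => z; rewrite /= !in_itv/= ltr_pdivrMr// ler_pdivlMr// ![z * _]mulrC.
rewrite !lebesgue_measure_itv/= !lte_fin ltr_pM2r ?invr_gt0//.
case: ifPn => _; last by rewrite mule0.
by rewrite -!EFinB -EFinM -mulrBl mulrC divfK// gt_eqF.
Qed.

Lemma ae_lebesgue_impl (R : realType) (P Q : R -> Prop) :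
  (forall x, P x -> Q x) -> {ae @lebesgue_measure R, forall x, P x} ->
  {ae @lebesgue_measure R, forall x, Q x}.
Proof.
exact: (@filterS _ _ (ae_filter_ringOfSetsType (@lebesgue_measure R))).
Qed.

Lemma ae_dilation (R : realType) (a : R) (P : R -> Prop) : 0 < a ->
  {ae @lebesgue_measure R, forall x, P x} ->
  {ae @lebesgue_measure R, forall x, P (a * x)}.
Proof.
move=> a0 [B [mB B0 PB]].
have mf : measurable_fun setT ( *%R a : measurableTypeR R -> measurableTypeR R).
  exact: mulrl_measurable.
exists (( *%R a) @^-1` B); split.
- by rewrite -[X in measurable X]setTI; exact: mf.
- have /eqP := lebesgue_measure_dilation a0 mB.
  by rewrite B0 mule_eq0 eqe gt_eqF// => /eqP.
- by move=> x /= Px; exact: PB.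
Qed.

Lemma measurable_hat (R : realType) (b : R) : measurable_fun setT (hat b).
Proof.
apply: measurable_maxr; first exact: measurable_cst.
apply: measurable_minr; first exact: measurable_id.
by apply: measurable_funB; [exact: measurable_cst|exact: measurable_id].
Qed.

Lemma normr_hat (R : realType) (b x : R) : `|hat b x| <= `|b|.
Proof.
rewrite /hat ger0_norm ?le_max ?lexx// ge_max normr_ge0/= ge_min.
have [x0|x0] := leP x 0; first by rewrite (le_trans x0).
by apply/orP; right; rewrite lerBlDr ler_wpDr ?ler_norm// ltW.
Qed.

Lemma lebesgue_measureT_gt0 (R : realType) :
  (0 < @lebesgue_measure R [set: R])%E.
Proof.
apply: (@lt_le_trans _ _ (@lebesgue_measure R `[0, 1]%classic)).
  by rewrite lebesgue_measure_itv/= lte_fin ltr01 oppr0 adde0 lte_fin.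
by apply: le_measure => //; rewrite inE.
Qed.

Lemma LinfP (R : realType) (g : nat -> R -> R) :
  Linf g <-> (forall n, (0 < n)%N -> measurable_fun setT (g n)) /\
    exists M : R, forall n, (0 < n)%N ->
      {ae @lebesgue_measure R, forall x, `|g n x| <= M}.
Proof.
(* The norm of exponent [+oo] unfolds to an essential supremum only when the whole space has
   positive measure. *)
have NE n : ('N[@lebesgue_measure R]_+oo[EFin \o g n]
    = ess_sup (@lebesgue_measure R) (abse \o (EFin \o g n)))%E.
  by rewrite unlock/= lebesgue_measureT_gt0.
rewrite /Linf/=; split=> -[mg].
  move=> sup_lt; split=> //.
  set s := ereal_sup _ in sup_lt.
  have s_ge n : (0 < n)%N -> ('N[@lebesgue_measure R]_+oo[EFin \o g n] <= s)%E.
    by move=> n0; apply: ereal_sup_ubound; exists n.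
  have sfin : s \is a fin_num.
    rewrite ge0_fin_numE//; apply: le_trans (s_ge 1%N isT); exact: Lnorm_ge0.
  exists (fine s) => n n0; have := s_ge n n0; rewrite NE => /ess_supP.
  by apply: ae_lebesgue_impl => x/=; rewrite -[s]fineK.
case=> M gM; split=> //; apply: (@le_lt_trans _ _ M%:E); last exact: ltry.
apply: ge_ereal_sup => _ [n n0 <-]; rewrite NE; apply/ess_supP.
by move: (gM n n0); apply: ae_lebesgue_impl => x /=; rewrite lee_fin.
Qed.

Lemma landscape_op_Linf (R : realType) (N : nat) (c : R) (del : nat -> R) g :
  0 < c -> Linf g -> Linf (landscape_op N c del g).
Proof.
move=> c0 /LinfP[mg [M gM]]; apply/LinfP; split.
  move=> n n0; rewrite /landscape_op; case: (n <= N)%N.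
    exact: measurable_hat.
  apply: measurable_funM; first by exact: measurable_cst.
  apply: (measurableT_comp (mg (n.-1 %/ N).+1 isT)).
  exact: mulrl_measurable.
(* The sum bounds the hat functions and the second term the rescaled ones; [M] itself is not known
   to be nonnegative. *)
exists (\sum_(j < N.+1) `|del j| + c * `|M|) => n n0.
rewrite /landscape_op; case: (leqP n N) => nN.
  apply: nearW => x; apply: le_trans (normr_hat _ _) _.
  rewrite (bigD1 (Ordinal (nN : n < N.+1)%N))//= -addrA lerDl addr_ge0//.
    by rewrite sumr_ge0.
  by rewrite mulr_ge0// ltW.
have := gM ((n.-1 %/ N).+1) isT.
have ic0 : 0 < c^-1 by rewrite invr_gt0.
move/(ae_dilation ic0); apply: ae_lebesgue_impl => x /= xM.
rewrite normrM gtr0_norm// ler_wpDl ?sumr_ge0//.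
by rewrite ler_pM2l// (le_trans xM)// ler_norm.
Qed.

Lemma landscape_op_Linf_eq (R : realType) (N : nat) (c : R) (del : nat -> R)
    g h :
  0 < c -> Linf_eq g h ->
  Linf_eq (landscape_op N c del g) (landscape_op N c del h).
Proof.
move=> c0 gh n n0; rewrite /landscape_op; case: (leqP n N) => nN.
  exact: nearW.
have ic0 : 0 < c^-1 by rewrite invr_gt0.
have /(ae_dilation ic0) := gh ((n.-1 %/ N).+1) isT.
by apply: ae_lebesgue_impl => x /= ->.
Qed.

(** * Self-similar sets *)

Section SelfSimilarSets.
Variables (R : realType) (d N : nat) (c : R).
Variables (psi : 'I_N -> 'rV[R]_d -> 'rV[R]_d) (A : set 'rV[R]_d).
Hypotheses (c0 : 0 < c) (c1 : c < 1).
Hypothesis psi_sim : forall i, similitude c (psi i).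
Hypothesis invA : invariant_set psi A.
Hypothesis sepA : well_separated psi A.
Implicit Types (x y : 'rV[R]_d) (n k l : nat) (u v : R).

Let D := diam A.
Let S := approx_set psi A.

Lemma invariant_eucl_le_diam x y : A x -> A y -> eucl x y <= D.
Proof.
by have [_ cA _] := invA; apply: eucl_le_diam; exact: compact_eucl_bounded.
Qed.

Lemma hutchinsonP (X : set 'rV[R]_d) y :
  hutchinson psi X y <-> exists i, exists2 x, X x & psi i x = y.
Proof.
split=> [[i _ [x Xx <-]]|[i [x Xx <-]]]; first by exists i, x.
by exists i => //; exists x.
Qed.

Lemma invariant_psi i x : A x -> A (psi i x).
Proof.
by have [_ _ AE] := invA; move=> Ax; rewrite AE; apply/hutchinsonP; exists i, x.
Qed.

Lemma invariant_decompose y : A y -> exists i, exists2 x, A x & psi i x = y.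
Proof. by have [_ _ {1}->] := invA => /hutchinsonP. Qed.

Lemma approx_setS n y : S n.+1 y <-> exists i, exists2 x, S n x & psi i x = y.
Proof. exact: hutchinsonP. Qed.

Lemma approx_set_sub n : S n `<=` A.
Proof.
elim: n => [|n IH] y; first exact: extreme_points_hull_sub.
by move=> /approx_setS[i [x /IH Ax <-]]; exact: invariant_psi.
Qed.

Lemma approx_set_nonempty n : S n !=set0.
Proof.
have [A0 cA _] := invA.
elim: n => [|n [x Sx]]; first exact: extreme_points_hull_nonempty.
have [a /invariant_decompose[i _]] := A0.
by exists (psi i x); apply/approx_setS; exists i, x.
Qed.

(** Lift a point of [A] to its preimage in a piece, approximate that one level lower, and let
    [psi i] contract the error by [c]. *)
Lemma approx_set_dense n x : A x -> exists2 s, S n s & eucl x s <= c ^+ n * D.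
Proof.
elim: n x => [|n IH] x Ax.
  have [s Ss] := approx_set_nonempty 0; exists s => //.
  by rewrite expr0 mul1r invariant_eucl_le_diam//; exact: approx_set_sub Ss.
have [i [a Aa <-]] := invariant_decompose Ax; have [s Ss as_le] := IH _ Aa.
exists (psi i s); first by apply/approx_setS; exists i, s.
by rewrite psi_sim exprS -mulrA ler_pM2l.
Qed.

Lemma psi_near i x y : A x -> A y -> eucl (psi i x) (psi i y) <= c * D.
Proof. by move=> Ax Ay; rewrite psi_sim ler_pM2l// invariant_eucl_le_diam. Qed.

(** Every piece has diameter at least [c * D], since its map scales all distances by [c];
    well-separated images turn this into a lower bound on the gaps. *)
Lemma psi_far i j x y : i != j -> A x -> A y ->
  c * D <= eucl (psi i x) (psi j y).
Proof.
move=> ij Ax Ay; rewrite -lee_fin.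
apply: (@le_trans _ _ (setdist (psi i @` A) (psi j @` A))); last first.
  by apply: setdist_le; [exists x|exists y].
apply: le_trans (sepA i ij); rewrite lee_fin mulrC -ler_pdivlMr//.
apply: diam_le => [|a b Aa Ab]; first by rewrite divr_ge0 ?diam_ge0// ltW.
rewrite ler_pdivlMr// mulrC -(psi_sim i); apply: eucl_le_diam.
- by exists (c * D) => _ _ [p Ap <-] [q Aq <-]; exact: psi_near.
- by exists a.
- by exists b.
Qed.

(** For [D > 0] the pieces are disjoint and the maps injective, so a point of [A] determines its
    piece and its preimage. For [D = 0] all pieces coincide. *)
Lemma address : 0 < D ->
  exists a : 'rV[R]_d -> 'I_N * 'rV[R]_d,
    forall i x, A x -> a (psi i x) = (i, x).
Proof.
move=> D0; have [[x0 /invariant_decompose[i0 _]] _ _] := invA.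
have /choice[a aP] : forall y, exists p : 'I_N * 'rV[R]_d,
    A y -> A p.2 /\ psi p.1 p.2 = y.
  move=> y; have [/invariant_decompose[i [x Ax <-]]|nAy] := pselect (A y).
    by exists (i, x).
  by exists (i0, x0).
exists a => i x Ax; have := aP _ (invariant_psi i Ax).
case: (a _) => j y /= [Ay yx].
have [ij|ji] := eqVneq j i; last first.
  have := psi_far ji Ay Ax; rewrite yx eucl_refl leNgt.
  by rewrite mulr_gt0.
congr (_, _) => //; apply: eucl_eq0; move: yx; rewrite ij => yx.
have /eqP := psi_sim i y x; rewrite yx eucl_refl eq_sym mulf_eq0.
by rewrite (gt_eqF c0) => /eqP.
Qed.

(* [A] is covered by [N ^ n] pieces of diameter at most [c ^+ n * D]. *)
Lemma splits_invariant_bound n u k : c ^+ n * D <= u -> splits A u k ->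
  (k <= N ^ n)%N.
Proof.
move=> nu [g [ge gs]].
suff [s sN sA] : exists2 s : seq nat, (size s <= N ^ n)%N &
    forall x, A x -> g x \in s.
  apply: leq_trans sN; rewrite -(size_iota 0 k); apply: uniq_leq_size.
    exact: iota_uniq.
  by move=> i; rewrite mem_iota => /gs[x Ax <-]; exact: sA.
elim: n u nu g ge {gs} => [|n IH] u nu g ge.
  have [[a Aa] _ _] := invA; exists [:: g a] => // x Ax.
  rewrite inE; apply/eqP/ge => //; rewrite expr0 mul1r in nu.
  exact: le_trans (invariant_eucl_le_diam Ax Aa) nu.
have /choice[s sP] : forall i, exists s : seq nat, (size s <= N ^ n)%N /\
    forall x, A x -> g (psi i x) \in s.
  move=> i; have [||s sN sA] := IH (u / c) _ (g \o psi i); last by exists s.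
    by rewrite ler_pdivlMr// mulrC mulrA -exprS.
  move=> x y Ax Ay xy; apply: ge; [exact: invariant_psi..|].
  by rewrite psi_sim mulrC -ler_pdivlMr.
exists (flatten [seq s i | i <- enum 'I_N]).
  rewrite size_flatten /shape -map_comp sumnE big_map big_enum/=.
  apply: leq_trans (_ : \sum_(i < N) N ^ n <= _)%N.
    by apply: leq_sum => i _; exact: (sP i).1.
  by rewrite sum_nat_const card_ord expnS.
move=> x /invariant_decompose[i [y Ay <-]]; apply/flattenP; exists (s i).
  by apply/mapP; exists i; rewrite ?mem_enum.
exact: (sP i).2.
Qed.

Lemma expr_to0 u : 0 < u -> exists n, forall m, (n <= m)%N -> c ^+ m * D < u.
Proof.
move=> u0.
have : (fun m => c ^+ m * D) @ \oo --> 0 * D.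
  by apply: cvgM; [apply: cvg_expr; rewrite ger0_norm ?ltW|exact: cvg_cst].
rewrite mul0r => /cvgr0_norm_lt/(_ _ u0)[n _ nP]; exists n => m nm.
by apply: le_lt_trans (nP m nm); exact: ler_norm.
Qed.

Lemma splits_invariant_bounded u : 0 < u ->
  exists M, forall k, splits A u k -> (k <= M)%N.
Proof.
move=> /expr_to0[n nP]; exists (N ^ n)%N => k.
by apply: splits_invariant_bound; apply/ltW/nP.
Qed.

Lemma delta_splits k : (1 < k)%N ->
  delta A k = inf [set e | 0 < e /\ ~ splits_above A e k].
Proof.
case: k => [|[|k]]// _; rewrite /delta/=; congr inf.
apply/seteqP; split=> e /= [e0 h]; split=> //;
  by have [M AM] := splits_invariant_bounded e0;
     apply/(card_eps_components _ (ltW e0) AM).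
Qed.

(* Pigeonhole: of more than [k * N] labels, some piece carries more than [k]. *)
Lemma splits_approxS n u k l : (0 < l)%N ->
  splits (S n.+1) u (k * N + l) -> splits (S n) (u / c) k.+1.
Proof.
case: l => // l _ [g [ge gs]].
pose T i := [seq j <- iota 0 (k * N + l.+1) |
  `[< exists2 x, S n x & g (psi i x) = j >]].
have [[i kT]|Tk] := pselect (exists i, k < size (T i))%N.
  apply: has_labels_leq kT _; apply: (@has_labels_seq _ _ _ _ (g \o psi i)).
  - move=> x y Sx Sy xy; apply: ge; [by apply/approx_setS; exists i, x|
      by apply/approx_setS; exists i, y|].
    by rewrite psi_sim mulrC -ler_pdivlMr.
  - by rewrite filter_uniq// iota_uniq.
  - by move=> j; rewrite mem_filter => /andP[/asboolP].
suff : (k * N + l.+1 <= k * N)%N by rewrite addnS ltnNge leq_addr.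
rewrite -[leqLHS](size_iota 0).
apply: leq_trans (_ : size (flatten [seq T i | i <- enum 'I_N]) <= _)%N.
  apply: uniq_leq_size; first exact: iota_uniq.
  move=> j jk; have := jk; rewrite mem_iota.
  move=> /gs[_ /approx_setS[i [x Sx <-]] gx].
  apply/flattenP; exists (T i).
    by apply/mapP; exists i; rewrite ?mem_enum.
  by rewrite mem_filter jk andbT; apply/asboolP; exists x.
rewrite size_flatten /shape -map_comp sumnE big_map big_enum/=.
apply: leq_trans (_ : \sum_(i < N) k <= _)%N; last first.
  by rewrite sum_nat_const card_ord mulnC.
by apply: leq_sum => i _; rewrite leqNgt; apply/negP => ki; apply: Tk; exists i.
Qed.

(** Below scale [c * D] distinct pieces are not linked, so the pair of piece index and pulled-back
    label is a labelling. The pair [(i, q)] is coded as [i + N * q], which takes all values below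
    [k.+1 * N]. *)
Lemma approxS_splits n u k l : 0 <= u -> u < c * D -> (l <= N)%N ->
  splits (S n) (u / c) k.+1 -> splits (S n.+1) u (k * N + l).
Proof.
move=> u0 ucD lN [g [ge gs]].
have D0 : 0 < D by rewrite -(pmulr_rgt0 _ c0) (le_lt_trans u0).
have [a aP] := address D0.
exists (fun y => (a y).1 + N * g (a y).2)%N; split.
  move=> _ _ /approx_setS[i [x Sx <-]] /approx_setS[j [y Sy <-]].
  have [Ax Ay] : A x /\ A y.
    by split; [exact: approx_set_sub Sx|exact: approx_set_sub Sy].
  rewrite !aP//= => xy; have [ij|ij] := eqVneq i j; last first.
    by have := psi_far ij Ax Ay; rewrite leNgt (le_lt_trans xy).
  congr (_ + _ * _)%N; first by rewrite ij.
  by apply: ge => //; move: xy; rewrite ij psi_sim mulrC -ler_pdivlMr.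
move=> q qkl; have qk : (q < k.+1 * N)%N.
  by rewrite (leq_trans qkl)// mulSn addnC leq_add2r.
have N0 : (0 < N)%N by case: N qk => //; rewrite muln0.
have [|x Sx gx] := gs (q %/ N)%N; first by rewrite ltn_divLR.
have qN : (q %% N < N)%N by rewrite ltn_mod.
exists (psi (Ordinal qN) x); first by apply/approx_setS; exists (Ordinal qN), x.
rewrite aP; last exact: approx_set_sub Sx.
by rewrite /= gx addnC mulnC -divn_eq.
Qed.

(** Below scale [c * D] the piece index is itself a labelling. *)
Lemma hutchinson_splits (X : set 'rV[R]_d) u k : X !=set0 -> X `<=` A ->
  0 <= u -> u < c * D -> (k <= N)%N -> splits (hutchinson psi X) u k.
Proof.
move=> [p Xp] XA u0 ucD kN.
have D0 : 0 < D by rewrite -(pmulr_rgt0 _ c0) (le_lt_trans u0).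
have [a aP] := address D0.
exists (fun y => (a y).1); split.
  move=> _ _ /hutchinsonP[i [x /XA Ax <-]] /hutchinsonP[j [y /XA Ay <-]] xy.
  rewrite !aP//=; have [->//|ij] := eqVneq i j.
  by have := psi_far ij Ax Ay; rewrite leNgt (le_lt_trans xy).
move=> i ik; exists (psi (Ordinal (leq_trans ik kN)) p).
  by apply/hutchinsonP; exists (Ordinal (leq_trans ik kN)), p.
by rewrite aP//; exact: XA.
Qed.

(** From scale [c * D] on, a labelling of [A] is constant on each piece, and every piece meets
    [S n.+1], so no label is lost by restriction. *)
Lemma splits_invariant_approx n u k : 0 <= u -> (k <= N)%N ->
  splits A u k -> splits (S n.+1) u k.
Proof.
move=> u0 kN [g [ge gs]]; have [ucD|cDu] := ltP u (c * D).
  apply: hutchinson_splits => //; first exact: approx_set_nonempty.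
  exact: approx_set_sub.
exists g; split=> [x y Sx Sy|i ik].
  by apply: ge; exact: (@approx_set_sub n.+1).
have [x Ax <-] := gs i ik; have [j [a Aa <-]] := invariant_decompose Ax.
have [p Sp] := approx_set_nonempty n; have Ap := approx_set_sub Sp.
exists (psi j p); first by apply/approx_setS; exists j, p.
apply: ge; [exact: invariant_psi..|].
exact: le_trans (psi_near j Ap Aa) cDu.
Qed.

(** * Comparison of the approximations with [A] when the distances between pieces are stable *)

Section StableDistances.
Hypothesis dist_stable : forall (j k : 'I_N) n, (1 <= n)%N ->
  setdist (psi j @` S n.+1) (psi k @` S n.+1) =
  setdist (psi j @` S n) (psi k @` S n).

(** By density a short link between pieces of [A] is approximated at level [n + m], and stability of
    the distances brings it back to level [n]. The slack below [u] is halved because both end points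
    move. *)
Lemma approx_near_points n i j x y u : (1 <= n)%N -> A x -> A y ->
  eucl (psi i x) (psi j y) < u ->
  exists s t, [/\ S n s, S n t & eucl (psi i s) (psi j t) < u].
Proof.
move=> n1 Ax Ay xyu; pose r := (u - eucl (psi i x) (psi j y)) / 2.
have r0 : 0 < r by rewrite divr_gt0// subr_gt0.
have [m mP] := expr_to0 r0.
have dE q : setdist (psi i @` S (n + q)) (psi j @` S (n + q)) =
    setdist (psi i @` S n) (psi j @` S n).
  elim: q => [|q IH]; first by rewrite addn0.
  by rewrite addnS dist_stable ?ltn_addr.
have cm : c ^+ (n + m) * D < r by apply: mP; exact: leq_addl.
have [s Ss xs] := approx_set_dense (n + m) Ax.
have [t St yt] := approx_set_dense (n + m) Ay.
have : (setdist (psi i @` S n) (psi j @` S n) < u%:E)%E.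
  rewrite -(dE m); apply: (@le_lt_trans _ _ (eucl (psi i s) (psi j t))%:E).
    by apply: setdist_le; [exists s|exists t].
  rewrite lte_fin.
  have h1 : eucl (psi i s) (psi i x) < r.
    rewrite psi_sim eucl_sym; apply: le_lt_trans (le_lt_trans xs cm).
    by rewrite ler_piMl ?eucl_ge0// ltW.
  have h2 : eucl (psi j y) (psi j t) < r.
    rewrite psi_sim; apply: le_lt_trans (le_lt_trans yt cm).
    by rewrite ler_piMl ?eucl_ge0// ltW.
  have := eucl_triangle (psi i x) (psi i s) (psi j t).
  have := eucl_triangle (psi j y) (psi i x) (psi j t).
  by move: h1 h2; rewrite /r; lra.
by move=> /setdist_lt[_ [_ [[a Sa <-] [b Sb <-] ab]]]; exists a, b.
Qed.

(** From scale [c * D] on, the labels of [S n.+1] are constant on pieces, so they define labels of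
    the pieces of [A]. A link of length at most [v] in [A] gives one shorter than [u] in [S n.+1];
    the loss from [u] to [v] does not affect suprema of scales. *)
Lemma splits_approx_invariant n u v k : (1 <= n)%N -> 0 <= v -> v < u ->
  (k <= N)%N -> splits (S n.+1) u k -> splits A v k.
Proof.
move=> n1 v0 vu kN [g [ge gs]].
have [A0 _ AE] := invA.
have [vcD|cDv] := ltP v (c * D).
  by rewrite AE; exact: hutchinson_splits.
have [p Sp] := approx_set_nonempty n; have Ap := approx_set_sub Sp.
have gp i s : S n s -> g (psi i s) = g (psi i p).
  move=> Ss; apply: ge; [by apply/approx_setS; exists i, s|
    by apply/approx_setS; exists i, p|].
  apply: le_trans (psi_near i (approx_set_sub Ss) Ap) _.
  exact: le_trans cDv (ltW vu).
have /choice[a aP] : forall y, exists i : 'I_N,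
    A y -> exists2 x, A x & psi i x = y.
  have [x0 /invariant_decompose[i0 _]] := A0.
  move=> y; have [/invariant_decompose[i h]|nAy] := pselect (A y).
    by exists i.
  by exists i0.
have g_link i j x y : A x -> A y -> eucl (psi i x) (psi j y) <= v ->
    g (psi i p) = g (psi j p).
  move=> Ax Ay xyv; have := approx_near_points n1 Ax Ay (le_lt_trans xyv vu).
  move=> [s [t [Ss St /ltW st]]]; rewrite -(gp _ _ Ss) -(gp _ _ St).
  by apply: ge => //; apply/approx_setS; [exists i, s|exists j, t].
(* A point gets the label of the base point of a chosen piece containing it. Pieces meet when
   [D = 0]; [g_link] makes the choice harmless. *)
exists (fun y => g (psi (a y) p)); split.
  move=> x y Ax Ay; have [x' Ax' {1}<-] := aP _ Ax.
  have [y' Ay' {1}<-] := aP _ Ay.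
  exact: g_link.
move=> q /gs[_ /approx_setS[i [s Ss <-]] <-]; exists (psi i p).
  exact: invariant_psi.
have [x Ax xp] := aP _ (invariant_psi i Ap); rewrite (gp i s Ss).
by apply: g_link Ax Ap _; rewrite xp eucl_refl.
Qed.

(** For [k = 1] every scale in [[0, D)] qualifies. For [k > 1] both sides equal [sup V]: the left
    one by transfer between [S n.+1] and [A], the right one because [W] is bounded below by [sup V]
    and contains everything above it. *)
Lemma sup_split_times_delta n k : (1 <= n)%N -> (0 < k <= N)%N ->
  sup (split_times D (S n.+1) k) = delta A k.
Proof.
move=> n1 /andP[k0 kN]; have [k1|k1] := leqP k 1.
  have -> : k = 1%N by apply/eqP; rewrite eqn_leq k1.
  rewrite /delta/=; apply: sup_nonneg_eq; first exact: diam_ge0.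
    by move=> m [-> /ltW].
  move=> v v0 vD; have [vm mD] := midf_lt vD; exists ((v + D) / 2) => //.
  split; [by rewrite (le_trans v0)// ltW|exact: mD|].
  by apply: has_labels1; exact: (approx_set_nonempty n.+1).
pose V := [set u | 0 <= u /\ splits A u k].
have VD u : V u -> u < D.
  move=> [_ uk]; rewrite ltNge; apply/negP => Du; apply: (splits_diam _ k1 uk).
  by move=> x y Ax Ay; exact: le_trans (invariant_eucl_le_diam Ax Ay) Du.
have Vub u : V u -> u <= sup V.
  move=> Vu; apply: sup_upper_bound => //; split; first by exists u.
  by exists D => w /VD/ltW.
have V0 : 0 <= sup V by apply: sup_nonneg => u [].
transitivity (sup V).
  apply: sup_nonneg_eq => // [m [m0 mD mk]|v v0 /(sup_gt_nonneg v0)[w Vw vw]].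
    rewrite m0 leNgt; apply/negP => Vm; have [Vl lm] := midf_lt Vm.
    have l0 := le_trans V0 (ltW Vl).
    have /Vub : V ((sup V + m) / 2).
      by split=> //; exact: splits_approx_invariant n1 l0 lm kN mk.
    by rewrite leNgt Vl.
  exists w => //; split; [exact: Vw.1|exact: VD|].
  by apply: splits_invariant_approx kN Vw.2; exact: Vw.1.
rewrite delta_splits//; set W := [set e | _].
have WP e : W e <-> 0 < e /\ forall u, V u -> u <= e.
  split=> [[e0 ne]|[e0 eV]]; split=> //.
    by move=> u [_ uk]; rewrite leNgt; apply/negP => eu; apply: ne; exists u.
  move=> [u eu uk]; have : V u by split=> //; exact: le_trans (ltW e0) (ltW eu).
  by move=> /eV; rewrite leNgt eu.
have sW e : sup V < e -> W e.
  move=> Ve; apply/WP; split; first exact: le_lt_trans Ve.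
  by move=> u /Vub uV; exact: le_trans uV (ltW Ve).
have Wlb : lbound W (sup V).
  (* [V] is empty when [A] is a single point; then [sup V] is 0 and [W] consists of positive
     numbers. *)
  move=> e /WP[e0 eV]; have [->|/set0P nV] := eqVneq V set0.
    by rewrite sup0 ltW.
  exact: sup_le_ub.
apply/eqP; rewrite eq_le; apply/andP; split.
  by apply: lb_le_inf => //; exists (sup V + 1); apply: sW; rewrite ltrDl.
rewrite leNgt; apply/negP => Vi; have [Vl li] := midf_lt Vi.
move: li; rewrite ltNge => /negP; apply.
by apply: ge_inf; [exists (sup V)|exact: sW].
Qed.

End StableDistances.

(** Since [k.+1 > 1], the split scales of [S n] lie below [D], and those of [S n.+1] below [c * D],
    where pieces are not linked; multiplication by [c] matches the two sets. *)
Lemma sup_split_times_scale n k l : (1 <= k)%N -> (0 < l <= N)%N ->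
  sup (split_times D (S n.+1) (k * N + l)) = c * sup (split_times D (S n) k.+1).
Proof.
move=> k1 /andP[l0 lN]; set V := split_times D (S n) k.+1.
have SD x y : S n x -> S n y -> eucl x y <= D.
  by move=> /approx_set_sub Ax /approx_set_sub; exact: invariant_eucl_le_diam.
have Vub u : V u -> u <= sup V.
  move=> Vu; apply: sup_upper_bound => //; split; first by exists u.
  by exists D => w [_ /ltW].
have V0 : 0 <= sup V by apply: sup_nonneg => u [].
apply: sup_nonneg_eq; first by rewrite mulr_ge0// ltW.
  move=> m [m0 mD /(splits_approxS l0) mk]; rewrite m0/=.
  rewrite mulrC -ler_pdivrMr// Vub//; split=> //.
    by rewrite divr_ge0// ltW.
  rewrite ltNge; apply/negP => Dm; apply: (splits_diam _ _ mk) => //.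
  by move=> x y Sx Sy; exact: le_trans (SD _ _ Sx Sy) Dm.
move=> v v0; rewrite mulrC -ltr_pdivrMr// => vV.
have [|w [w0 wD wk] vw] := sup_gt_nonneg _ vV; first by rewrite divr_ge0// ltW.
exists (c * w); last by rewrite mulrC -ltr_pdivrMr.
have cw0 : 0 <= c * w by rewrite mulr_ge0// ltW.
split=> //; first by apply: le_lt_trans wD; rewrite ler_piMl// ltW.
apply: approxS_splits => //; first by rewrite ltr_pM2l.
by rewrite mulrC mulKf// gt_eqF.
Qed.

Lemma landscape_approx n k : (0 < k)%N ->
  landscape D (S n) k = hat (sup (split_times D (S n) k)).
Proof.
move=> k0; apply: landscape_hat => // x y.
by move=> /approx_set_sub Ax /approx_set_sub; exact: invariant_eucl_le_diam.
Qed.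

Lemma landscape_approx_Linf n : Linf (landscape D (S n)).
Proof.
apply/LinfP; split=> [k k0|].
  by rewrite landscape_approx//; exact: measurable_hat.
exists D => k k0; rewrite landscape_approx//; apply: nearW => x.
apply: le_trans (normr_hat _ _) _.
rewrite ger0_norm; last by apply: sup_nonneg => u [].
have [->|/set0P V0] := eqVneq (split_times D (S n) k) set0.
  by rewrite sup0 diam_ge0.
by apply: sup_le_ub => // u [_ /ltW].
Qed.

End SelfSimilarSets.

Lemma hat_scale (R : realType) (c b x : R) : 0 < c ->
  hat (c * b) x = c * hat b (c^-1 * x).
Proof.
move=> c0; rewrite /hat maxr_pMr ?ltW// mulr0 minr_pMr ?ltW//.
by rewrite mulrBr mulVKf// gt_eqF.
Qed.

Theorem theorem5 (R : realType) (d N : nat) (c : R)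
    (psi : 'I_N -> 'rV[R]_d -> 'rV[R]_d) (A : set 'rV[R]_d) :
  (0 < d)%N -> (0 < N)%N -> 0 < c < 1 ->
  (forall i : 'I_N, similitude c (psi i)) ->
  invariant_set psi A ->
  well_separated psi A ->
  (forall (j k : 'I_N) (n : nat), (1 <= n)%N ->
     setdist (psi j @` approx_set psi A n.+1) (psi k @` approx_set psi A n.+1) =
     setdist (psi j @` approx_set psi A n) (psi k @` approx_set psi A n)) ->
  let f (n : nat) : nat -> R -> R := landscape (diam A) (approx_set psi A n) in
  let Lop : (nat -> R -> R) -> nat -> R -> R := landscape_op N c (delta A) in
  [/\ (forall n : nat, Linf (f n)),
      (forall g : nat -> R -> R, Linf g -> Linf (Lop g)),
      (forall g h : nat -> R -> R, Linf g -> Linf h ->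
        Linf_eq g h -> Linf_eq (Lop g) (Lop h))
    & forall n : nat, (1 <= n)%N -> Linf_eq (Lop (f n)) (f n.+1)].
Proof.
move=> _ N0 /andP[c0 c1] psi_sim invA sepA dist_stable f Lop; split.
- by move=> n; exact: (landscape_approx_Linf invA).
- by move=> g; exact: landscape_op_Linf.
- by move=> g h _ _; exact: landscape_op_Linf_eq.
move=> n n1 j j0; apply: nearW => x; rewrite /f (landscape_approx invA)//.
have [jN|Nj] := leqP j N.
  rewrite /Lop landscape_op_hat ?j0//.
  by rewrite (sup_split_times_delta c0 c1 psi_sim invA sepA dist_stable) ?j0.
(* Dividing [j.-1] instead of [j] puts the shifted remainder in the range from 1 to [N]. *)
have jE : (j = j.-1 %/ N * N + (j.-1 %% N).+1)%N.
  by rewrite addnS -divn_eq prednK.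
have k1 : (1 <= j.-1 %/ N)%N by rewrite divn_gt0// -ltnS prednK.
have lN : (1 <= (j.-1 %% N).+1 <= N)%N by rewrite ltn_mod.
rewrite jE /Lop landscape_op_scale// (landscape_approx invA)//.
by rewrite (sup_split_times_scale c0 c1 psi_sim invA sepA)// hat_scale.
Qed.
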